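(* Let $\mathcal M=(\mathbf M^{(\lambda)})_{\lambda>0}$ be a weight matrix on $\mathbb N_0^d$ such that for every $\lambda>0$ there exist $\kappa\ge\lambda$ and $A\ge1$ with $M^{(\lambda)}_{\alpha+e_j}\le A^{|\alpha|+1}M^{(\kappa)}_\alpha$ for all $\alpha\in\mathbb N_0^d$ and $1\le j\le d$. Then the sequence space $\Lambda_{\{\mathcal M\}}$ is nuclear.
   Context: A weight matrix is a family $\mathcal M=(\mathbf M^{(\lambda)})_{\lambda>0}$ with $\mathbf M^{(\lambda)}=(M^{(\lambda)}_\alpha)_{\alpha\in\mathbb N_0^d}$ sequences of positive reals, $M^{(\lambda)}_0=1$, and $M^{(\lambda)}_\alpha\le M^{(\kappa)}_\alpha$ for all $\alpha$ whenever $0<\lambda\le\kappa$. $e_j$ denotes the $j$-th unit vector, $|\alpha|=\sum\alpha_j$. The associated weight function of $\mathbf M=(M_\alpha)$ is $\omega_{\mathbf M}(t)=\sup_{\alpha\in\mathbb N^d_{0,t}}\log\frac{|t^\alpha|}{M_\alpha}$ ($t\in\mathbb R^d$), where $\mathbb N^d_{0,t}=\{\alpha:\alpha_j=0\text{ whenever }t_j=0\}$ and $0^0:=1$. With $\alpha^{1/2}=(\alpha_1^{1/2},\dots,\alpha_d^{1/2})$ and $\|\mathbf c\|_{\mathbf M,h}:=\sup_\alpha|c_\alpha|e^{\omega_{\mathbf M}(\alpha^{1/2}/h)}$, $\Lambda_{\{\mathcal M\}}$ is the space of $\mathbf c\in\mathbb C^{\mathbb N_0^d}$ with $\|\mathbf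 c\|_{\mathbf M^{(\lambda)},h}<\infty$ for some $\lambda,h>0$, with the inductive limit topology of the normed spaces $\{\mathbf c:\|\mathbf c\|_{\mathbf M^{(j)},j}<\infty\}$, $j\in\mathbb N$. *)

(* Defs.v *)
From HB Require Import structures.
From mathcomp Require Import all_boot all_order all_algebra.
From mathcomp Require Import all_classical all_reals all_analysis.
From mathcomp Require Import complex.

Set Implicit Arguments.
Unset Strict Implicit.
Unset Printing Implicit Defensive.

Import Order.TTheory GRing.Theory Num.Theory.
Local Open Scope ring_scope.
Local Open Scope classical_set_scope.

Definition mindex (d : nat) := 'I_d -> nat.

Definition unitvec (d : nat) (j : 'I_d) : mindex d := fun i => (i == j : nat).

Definition maddn (d : nat) (a b : mindex d) : mindex d := fun i => (a i + b i)%N.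

Definition mlen (d : nat) (a : mindex d) : nat := (\sum_(i < d) a i)%N.

Definition mzero (d : nat) : mindex d := fun _ => 0%N.

Definition weight_matrix (R : realType) (d : nat) (M : R -> mindex d -> R) :=
  [/\ forall l a, 0 < l -> 0 < M l a,
      forall l, 0 < l -> M l (@mzero d) = 1
    & forall l k a, 0 < l -> l <= k -> M l a <= M k a].

(* |t^alpha| = prod_j |t_j|^alpha_j (with 0^0 = 1) *)
Definition mpow_abs (R : realType) (d : nat) (t : 'I_d -> R) (a : mindex d) : R :=
  \prod_(j < d) `|t j| ^+ a j.

Definition omegaM (R : realType) (d : nat) (Mseq : mindex d -> R) (t : 'I_d -> R)
  : \bar R :=
  ereal_sup [set (ln (mpow_abs t a / Mseq a))%:E |
             a in [set a : mindex d | forall j, t j = 0 -> a j = 0%N]].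

Definition msqrt (R : realType) (d : nat) (a : mindex d) : 'I_d -> R :=
  fun j => Num.sqrt ((a j)%:R).

Definition seqnorm (R : realType) (d : nat) (Mseq : mindex d -> R) (h : R)
  (c : mindex d -> R[i]) : \bar R :=
  ereal_sup [set ((Normc.normc (c a))%:E
                  * expeR (omegaM Mseq (fun j => (@msqrt R d a j / h)%R)))%E | a in setT].

Definition LambdaR (R : realType) (d : nat) (M : R -> mindex d -> R)
  : set (mindex d -> R[i]) :=
  [set c | exists l h : R, [/\ 0 < l, 0 < h & (seqnorm (M l) h c < +oo)%E]].

(* The step spaces E_j = {c : ||c||_{M^(j), j} < oo}, j in N, j >= 1 *)
Definition stepnorm (R : realType) (d : nat) (M : R -> mindex d -> R) (j : nat)
  (c : mindex d -> R[i]) : \bar R := seqnorm (M j%:R) j%:R c.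

Definition sadd (R : realType) (d : nat) (x y : mindex d -> R[i]) : mindex d -> R[i] :=
  fun a => x a + y a.
Definition sscale (R : realType) (d : nat) (s : R[i]) (x : mindex d -> R[i])
  : mindex d -> R[i] := fun a => s * x a.

Definition seminorm_on (R : realType) (d : nat) (E : set (mindex d -> R[i]))
  (p : (mindex d -> R[i]) -> R) :=
  [/\ forall x, E x -> 0 <= p x,
      forall x y, E x -> E y -> p (sadd x y) <= p x + p y
    & forall s x, E x -> p (sscale s x) = Normc.normc s * p x].

(* Continuous seminorms for the locally convex inductive limit topology of the
   normed spaces E_j (j >= 1): a seminorm is continuous iff its restriction
   to every step E_j is bounded by a multiple of the step norm. *)
Definition cont_seminorm (R : realType) (d : nat) (M : R -> mindex d -> R)
  (p : (mindex d -> R[i]) -> R) :=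
  seminorm_on (LambdaR M) p /\
  forall j : nat, (0 < j)%N -> exists C : R, forall c,
      (stepnorm M j c < +oo)%E -> ((p c)%:E <= C%:E * stepnorm M j c)%E.

Definition linear_on (R : realType) (d : nat) (E : set (mindex d -> R[i]))
  (f : (mindex d -> R[i]) -> R[i]) :=
  (forall x y, E x -> E y -> f (sadd x y) = f x + f y) /\
  (forall s x, E x -> f (sscale s x) = s * f x).

(* Nuclearity (Pietsch): for every continuous seminorm p there are a continuous
   seminorm q and linear forms f_n with |f_n| <= a_n q, sum a_n < oo, such that
   p(x) <= sum_n |f_n(x)|  (i.e. the canonical map E_q -> E_p is quasinuclear). *)
Definition nuclear_Lambda (R : realType) (d : nat) (M : R -> mindex d -> R) :=
  forall p, cont_seminorm M p ->
  exists q, cont_seminorm M q /\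
  exists (f : nat -> (mindex d -> R[i]) -> R[i]) (a : nat -> R),
    [/\ forall n, linear_on (LambdaR M) (f n),
        forall n, 0 <= a n,
        forall n x, LambdaR M x -> Normc.normc (f n x) <= a n * q x,
        (\sum_(0 <= n <oo) (a n)%:E < +oo)%E
      & forall x, LambdaR M x ->
          ((p x)%:E <= \sum_(0 <= n <oo) (Normc.normc (f n x))%:E)%E].

(* Main.v *)
Require Import Defs.
From HB Require Import structures.
From mathcomp Require Import all_boot all_order all_algebra.
From mathcomp Require Import all_classical all_reals all_analysis.
From mathcomp Require Import complex lra ring.
Import Order.TTheory GRing.Theory Num.Theory.
Import numFieldNormedType.Exports.
Local Open Scope ring_scope.
Local Open Scope classical_set_scope.

(** Write [w_j a = exp (omega_{M^(j)} (a^(1/2) / j))] for the weight of the j-th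
    step. One application of the hypothesis on [M] bounds
    [max(1, |t_i|) e^(omega_k t)] by [e^(omega_l (A t))]; four applications in
    each coordinate give [prod_i (1 + a_i)^2 w_m a <= C w_j a] for some [m], and
    [prod_i (1 + a_i)^-2] is summable over [N^d]. Given a continuous seminorm
    [p], let [e_a] be the unit sequences and take
    [q x = sup_a |x_a| p(e_a) prod_i (1 + a_i)^2] and [f_a x = x_a p(e_a)]. The
    weight estimate makes [q] continuous and makes the expansion of [x] in unit
    sequences converge in a larger step, so that [p x <= sum_a |f_a x|]. *)

(** * Growth of associated weight functions under the shift hypothesis *)

Section AssociatedWeight.
Context {R : realType} {d : nat}.
Implicit Types (t : 'I_d -> R) (a : mindex d) (Mseq : mindex d -> R).

Lemma mpow_abs_scale (A : R) t a : 0 <= A ->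
  mpow_abs (fun i => A * t i) a = A ^+ mlen a * mpow_abs t a.
Proof.
move=> A0; rewrite /mpow_abs /mlen -prodrXr -big_split /=.
by apply: eq_bigr => i _; rewrite normrM (ger0_norm A0) exprMn.
Qed.

Lemma mpow_abs_shift t a j :
  mpow_abs t (maddn a (unitvec j)) = `|t j| * mpow_abs t a.
Proof.
rewrite /mpow_abs (bigD1 j) //= [in RHS](bigD1 j) //= mulrA.
rewrite /maddn /unitvec eqxx addn1 exprS; congr (_ * _).
by apply: eq_bigr => i /negPf ->; rewrite addn0.
Qed.

Lemma mlen_shift a j : mlen (maddn a (unitvec j)) = (mlen a).+1.
Proof.
rewrite /mlen /maddn big_split /= -addn1; congr addn.
by rewrite /unitvec -big_mkcond /= big_pred1_eq.
Qed.

Lemma mpow_abs_gt0 t a : (forall j, t j = 0 -> a j = 0%N) -> 0 < mpow_abs t a.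
Proof.
move=> ta; apply: prodr_gt0 => j _.
have [/ta ->|tj] := eqVneq (t j) 0; first by rewrite expr0.
by rewrite exprn_gt0 ?normr_gt0.
Qed.

Lemma le_mpow_abs t t' a : (forall j, `|t j| <= `|t' j|) ->
  mpow_abs t a <= mpow_abs t' a.
Proof.
move=> tt'; apply: ler_prod => j _; rewrite exprn_ge0//=.
by rewrite lerXn2r ?nnegrE.
Qed.

(** Every multi-index admissible for [t] is admissible for [t'], and its term only grows when [|t|]
    grows or the denominator shrinks. *)
Lemma le_omegaM Mseq Mseq' t t' : (forall a, 0 < Mseq' a) ->
  (forall a, Mseq' a <= Mseq a) ->
  (forall j, t' j = 0 -> t j = 0) -> (forall j, `|t j| <= `|t' j|) ->
  (omegaM Mseq t <= omegaM Mseq' t')%E.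
Proof.
move=> M0 MM t0 tt'; apply: ge_ereal_sup => _ [a /= ta <-].
apply: le_ereal_sup_tmp; exists (ln (mpow_abs t' a / Mseq' a))%:E.
  by exists a => //= j /t0 /ta.
have Ma : 0 < Mseq a by exact: lt_le_trans (M0 a) (MM a).
have pt : 0 < mpow_abs t a by exact: mpow_abs_gt0.
have pt' : mpow_abs t a <= mpow_abs t' a by exact: le_mpow_abs.
rewrite lee_fin ler_ln ?posrE ?divr_gt0 ?(lt_le_trans pt pt')//.
by apply: ler_pM; rewrite ?lef_pV2 ?posrE ?invr_ge0 ?(ltW pt) ?(ltW Ma).
Qed.

(** For [|t j| <= 1] this is monotonicity. Otherwise the term of [a] for [Mk], multiplied by
    [|t j|], is compared with the term of [a + e_j] for [Ml] at [A t]: the dilation produces exactly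
    the power [A ^+ (mlen a).+1] that the hypothesis costs. *)
Lemma omegaM_shift (Ml Mk : mindex d -> R) (A : R) :
  1 <= A -> (forall a, 0 < Ml a) -> (forall a, Ml a <= Mk a) ->
  (forall a j, Ml (maddn a (unitvec j)) <= A ^+ (mlen a).+1 * Mk a) ->
  forall t j, ((ln (Num.max 1 `|t j|))%:E + omegaM Mk t
               <= omegaM Ml (fun i => A * t i)%R)%E.
Proof.
move=> A1 Ml0 MM MA t j; have A0 : 0 < A by exact: lt_le_trans A1.
have [tj|tj] := leP `|t j| 1.
  rewrite ln1 add0e; apply: le_omegaM => //.
    by move=> i /eqP; rewrite mulf_eq0 gt_eqF//= => /eqP.
  by move=> i; rewrite normrM (gtr0_norm A0) ler_peMl.
rewrite -leeBrDl//; apply: ge_ereal_sup => _ [a ta <-].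
rewrite leeBrDl//; apply: le_ereal_sup_tmp.
have t0 : t j != 0 by rewrite -normr_gt0 (lt_trans _ tj).
set a' := maddn a (unitvec j).
exists (ln (mpow_abs (fun i => A * t i) a' / Ml a'))%:E.
  (* Raising the [j]-th exponent keeps the index admissible because [t j != 0]. *)
  exists a' => //= i /eqP; rewrite mulf_eq0 gt_eqF//= => /eqP ti.
  rewrite /a' /maddn ta// /unitvec; case: eqP => // ij.
  by rewrite -ij ti eqxx in t0.
have pt : 0 < mpow_abs t a by exact: mpow_abs_gt0.
have Mk0 : 0 < Mk a by exact: lt_le_trans (Ml0 a) (MM a).
have tj0 : 0 < `|t j| by rewrite normr_gt0.
rewrite -EFinD lee_fin -lnM ?posrE ?divr_gt0//.
rewrite mpow_abs_scale ?(ltW A0)// mpow_abs_shift mlen_shift.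
have An : 0 < A ^+ (mlen a).+1 by rewrite exprn_gt0.
rewrite ler_ln ?posrE ?mulr_gt0 ?invr_gt0//.
rewrite mulrA ler_pdivrMr// [leRHS]mulrAC ler_pdivlMr// [leRHS]mulrAC.
rewrite [leRHS]mulrC; apply: ler_wpM2l; first by rewrite mulr_ge0 ?ltW.
exact: MA.
Qed.


Definition tmult (t : 'I_d -> R) (i : 'I_d) : R := Num.max 1 `|t i|.

Lemma tmult_ge1 t i : 1 <= tmult t i.
Proof. by rewrite le_max lexx. Qed.

Lemma prod_tmult_gt0 t (s : seq 'I_d) : 0 < \prod_(i <- s) tmult t i.
Proof. by apply: prodr_gt0 => i _; exact: lt_le_trans (tmult_ge1 t i). Qed.

Definition shift_stable (M : R -> mindex d -> R) : Prop :=
  forall l : R, 0 < l -> exists k A : R, [/\ l <= k, 1 <= A &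
    forall (a : mindex d) (j : 'I_d),
      M l (maddn a (unitvec j)) <= A ^+ (mlen a).+1 * M k a].

(** One application of [omegaM_shift] per entry of [s], where repetitions are allowed. The new entry
    replaces [t] by [A' t], which does not decrease the remaining factors as [A' >= 1], so the
    induction hypothesis applies at [A' t] and the dilations multiply. *)
Lemma omegaM_growth (M : R -> mindex d -> R) : weight_matrix M ->
  shift_stable M ->
  forall (s : seq 'I_d) (l : R), 0 < l -> exists k A : R, [/\ l <= k, 1 <= A &
    forall t, ((ln (\prod_(i <- s) tmult t i))%:E + omegaM (M k) t
               <= omegaM (M l) (fun i => A * t i)%R)%E].
Proof.
move=> [M0 _ MM] MA; elim=> [|j s IH] l l0.
  exists l, 1; split => // t; rewrite big_nil ln1 add0e.
  by apply: le_omegaM => // [a|i|i]; rewrite ?M0 ?mul1r.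
have [k [A [lk A1 kA]]] := IH l l0; have k0 := lt_le_trans l0 lk.
have [k' [A' [kk' A'1 k'A']]] := MA k k0.
exists k', (A * A'); split.
- exact: le_trans kk'.
- by rewrite mulr_ege1.
move=> t; rewrite big_cons lnM ?posrE ?prod_tmult_gt0 ?(lt_le_trans _ (tmult_ge1 _ _))//.
rewrite EFinD addeAC addeC.
have -> : (fun i => A * A' * t i) = (fun i => A * (A' * t i)).
  by apply/funext => i; rewrite mulrA.
apply: le_trans (kA (fun i => A' * t i)); apply: leeD.
  rewrite lee_fin ler_ln ?posrE ?prod_tmult_gt0//.
  apply: ler_prod => i _; rewrite (le_trans _ (tmult_ge1 t i))//=.
  rewrite /tmult ge_max !le_max lexx/= normrM.
  by rewrite (ger0_norm (le_trans ler01 A'1)) ler_peMl// orbT.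
apply: omegaM_shift => // a; [exact: M0|exact: MM].
Qed.

(** Extended-real values are essential: the supremum defining [omegaM] can be infinite. *)
Definition wt Mseq (h : R) a : \bar R :=
  expeR (omegaM Mseq (fun j => (@msqrt R d a j / h)%R)).

Lemma le_wt Mseq Mseq' h h' a : (forall a, 0 < Mseq' a) ->
  (forall a, Mseq' a <= Mseq a) -> 0 < h' -> h' <= h ->
  (wt Mseq h a <= wt Mseq' h' a)%E.
Proof.
move=> M0 MM h0 hh; rewrite /wt lee_expeR; have h'0 := lt_le_trans h0 hh.
apply: le_omegaM => // j.
  by move=> /eqP; rewrite mulf_eq0 invr_eq0 (gt_eqF h0) orbF => /eqP ->; rewrite mul0r.
rewrite !normrM ler_wpM2l// !gtr0_norm ?invr_gt0//.
by rewrite lef_pV2 ?posrE.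
Qed.

Definition polywt a : R := \prod_(i < d) (1 + (a i)%:R) ^+ 2.

Lemma polywt_gt0 a : 0 < polywt a.
Proof. by apply: prodr_gt0 => i _; rewrite exprn_gt0// ltr_wpDr. Qed.

(** With [T] the truncated coordinate, both [a_i = m^2 (a_i^(1/2) / m)^2] and 1 are at most
    [m^2 T^2]; hence the factor 2. *)
Lemma succ_le_tmult (m : R) a i : 1 <= m ->
  1 + (a i)%:R <= 2 * m ^+ 2 * tmult (fun j => @msqrt R d a j / m) i ^+ 2.
Proof.
move=> m1; have m0 : 0 < m by exact: lt_le_trans m1.
set T := tmult _ _; have T1 : 1 <= T by exact: tmult_ge1.
have m2 : 1 <= m ^+ 2 by rewrite exprn_ege1.
have T2 : 1 <= T ^+ 2 by rewrite exprn_ege1.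
have : (a i)%:R <= m ^+ 2 * T ^+ 2 :> R.
  rewrite -[leLHS]sqr_sqrtr ?ler0n// -exprMn lerXn2r ?nnegrE ?sqrtr_ge0//.
    by rewrite mulr_ge0 ?(le_trans ler01).
  rewrite mulrC -ler_pdivrMr//; apply: le_trans (ler_norm _) _.
  by rewrite /T /tmult le_max lexx orbT.
have : 1 <= m ^+ 2 * T ^+ 2 by rewrite mulr_ege1.
by rewrite -mulrA; lra.
Qed.

Lemma wt_growth (M : R -> mindex d -> R) : weight_matrix M ->
  shift_stable M ->
  forall j : nat, (0 < j)%N -> exists m : nat, (0 < m)%N /\ exists C : R, 0 < C /\
    forall a, ((polywt a)%:E * wt (M m%:R) m%:R a
               <= C%:E * wt (M j%:R) j%:R a)%E.
Proof.
move=> wM MA j j0; have [M0 _ MM] := wM.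
(* Four factors [(1 + a_i)^(1/2)] per coordinate make up [polywt]. *)
pose e := enum 'I_d; pose s := e ++ e ++ e ++ e.
have jR : 0 < j%:R :> R by rewrite ltr0n.
have [k [A [jk A1 kA]]] := omegaM_growth M wM MA s _ jR.
have k0 := lt_le_trans jR jk.
have A0 : 0 < A by exact: lt_le_trans A1.
(* [m >= k] lets the weight of [M m] be compared with that of [M k]; [m >= A j] turns the dilated
   argument [A a^(1/2) / m] into at most [a^(1/2) / j]. *)
have [m mP] : exists m : nat, Num.max k (A * j%:R) <= m%:R.
  exists (Num.bound (Num.max k (A * j%:R))).
  by rewrite ltW// archi_boundP// le_max (ltW k0).
move: mP; rewrite ge_max => /andP[km Am].
have m0 : 0 < m%:R :> R by exact: lt_le_trans km.
have m1 : 1 <= m%:R :> R by rewrite ler1n -(ltr0n R).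
exists m; split; first by rewrite -(ltr0n R).
exists (\prod_(i < d) (2 * m%:R ^+ 2) ^+ 2); split.
  by apply: prodr_gt0 => i _; rewrite exprn_gt0// mulr_gt0// exprn_gt0.
move=> a; pose t i := @msqrt R d a i / m%:R.
have step : ((\prod_(i <- s) tmult t i)%:E * wt (M m%:R) m%:R a
             <= wt (M j%:R) j%:R a)%E.
  apply: (@le_trans _ _ (expeR ((ln (\prod_(i <- s) tmult t i))%:E + omegaM (M k) t))).
    rewrite expeRD /= lnK ?posrE ?prod_tmult_gt0//.
    apply: lee_wpmul2l; first by rewrite lee_fin ltW// prod_tmult_gt0.
    rewrite lee_expeR; apply: le_omegaM => // b; [exact: M0|exact: MM].
  rewrite lee_expeR; apply: le_trans (kA t) _; apply: le_omegaM => // i.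
  - exact: M0.
  - by move=> /eqP; rewrite /t mulf_eq0 invr_eq0 (gt_eqF jR) orbF => /eqP ->; rewrite mul0r mulr0.
  - rewrite /t mulrCA !normrM ler_wpM2l// -normrM !gtr0_norm ?invr_gt0 ?divr_gt0//.
    by rewrite ler_pdivrMr// mulrC ler_pdivlMr.
apply: le_trans (lee_wpmul2l _ step); last first.
  by rewrite lee_fin prodr_ge0// => i _; rewrite exprn_ge0// mulr_ge0// exprn_ge0.
rewrite muleA; apply: lee_wpmul2r; first exact: expeR_ge0.
rewrite -EFinM lee_fin /s !big_cat /= /e !big_enum -!big_split /=.
apply: ler_prod => i _; rewrite exprn_ge0 ?addr_ge0//=.
have -> : forall x y : R, x ^+ 2 * (y * (y * (y * y))) = (x * y ^+ 2) ^+ 2.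
  by move=> x y; ring.
have le1 := succ_le_tmult m%:R a i m1; have ge0 : 0 <= 1 + (a i)%:R :> R by rewrite addr_ge0.
by rewrite lerXn2r ?nnegrE// (le_trans ge0).
Qed.

End AssociatedWeight.

(** * Enumeration of multi-indices and summability of the inverse polynomial weights *)

Section Enumeration.
Context {R : realType} {d : nat}.

(** Telescoping, from [1/(1+x)^2 <= 1/x - 1/(1+x)]; the term [- K^-1] is what makes the induction
    close. At [K = 0] the convention [0^-1 = 0] applies, so the induction proper starts from
    [K = 1]. *)
Lemma sum_inv_sqr_le (K : nat) :
  \sum_(i < K) ((1 + i%:R) ^+ 2)^-1 <= 2 - K%:R^-1 :> R.
Proof.
elim: K => [|[|K] IH]; first by rewrite big_ord0 invr0 subr0.
  by rewrite big_ord1 addr0 expr1n invr1; lra.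
rewrite big_ord_recr /=; apply: le_trans (lerD IH (lexx _)) _ => {IH}.
set x : R := K.+1%:R; have x0 : 0 < x by rewrite ltr0n.
have -> : K.+2%:R = 1 + x by rewrite -natr1 addrC.
have -> : ((1 + x) ^+ 2)^-1 = (x^-1 - (1 + x)^-1) * (x / (1 + x)).
  by field; rewrite !gt_eqF// addr_gt0.
have q1 : x / (1 + x) <= 1 by rewrite ler_pdivrMr ?addr_gt0// mul1r lerDr.
have : (x^-1 - (1 + x)^-1) * (x / (1 + x)) <= x^-1 - (1 + x)^-1.
  by rewrite ler_piMr// subr_ge0 lef_pV2 ?posrE ?addr_gt0// lerDr.
by rewrite -addrA lerD2l [X in _ -> X <= _]addrC lerBlDr [X in _ -> _ <= X]addrC.
Qed.

Lemma ler_sum_uniq_sub {T : eqType} (F : T -> R) (s s' : seq T) :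
  (forall x, 0 <= F x) -> uniq s -> uniq s' -> {subset s <= s'} ->
  \sum_(x <- s) F x <= \sum_(x <- s') F x.
Proof.
move=> F0 us us' ss'.
have -> : \sum_(x <- s) F x = \sum_(x <- [seq x <- s' | x \in s]) F x.
  apply: perm_big; apply: uniq_perm => //; first exact: filter_uniq.
  by move=> x; rewrite mem_filter; have [/ss' ->|] := boolP (x \in s).
rewrite big_filter [leRHS](bigID (mem s))/= lerDl.
exact: sumr_ge0.
Qed.

(** By distributivity the sum over a box is a product of [d] one-dimensional sums, each at most
    2. *)
Lemma sum_polywt_box (K : nat) :
  \sum_(h : {ffun 'I_d -> 'I_K}) (@polywt R d (fun i => h i : nat))^-1 <= 2 ^+ d.
Proof.
under eq_bigr => h _ do rewrite /polywt -prodfV.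
rewrite -(bigA_distr_bigA (fun _ (j : 'I_K) => ((1 + j%:R) ^+ 2)^-1)) /=.
rewrite -[leRHS](_ : \prod_(i < d) (2 : R) = _); last by rewrite big_const_ord iter_mulr_1.
apply: ler_prod => i _; apply/andP; split.
  by apply: sumr_ge0 => j _; rewrite invr_ge0 sqr_ge0.
apply: le_trans (sum_inv_sqr_le K) _.
by rewrite gerBl invr_ge0.
Qed.

(** Finite functions form a countable type, which supplies the numbering. Decoding is partial, since
    a natural number need not be a code. *)
Definition mcode (a : mindex d) : nat := pickle (finfun a).
Definition mdecode (n : nat) : option {ffun 'I_d -> nat} := pickle_inv n.

Lemma mcodeK (a : mindex d) : mdecode (mcode a) = Some (finfun a).
Proof. exact: pickleK_inv. Qed.

Lemma mdecodeK n g : mdecode n = Some g -> mcode g = n.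
Proof.
move=> dn; have := @pickle_invK {ffun 'I_d -> nat} n.
rewrite /oapp -/(mdecode n) dn /mcode => <-; congr pickle.
by apply/ffunP => i; rewrite ffunE.
Qed.

Lemma mcode_inj : injective mcode.
Proof.
move=> a a' /(pcan_inj pickleK) aa'; apply/funext => i.
by have /ffunP/(_ i) := aa'; rewrite !ffunE.
Qed.

(** The default 0 makes numbers that code nothing invisible in the series. *)
Definition invwt (n : nat) : R :=
  oapp (fun g : {ffun 'I_d -> nat} => (@polywt R d g)^-1) 0 (mdecode n).

Lemma invwt_ge0 n : 0 <= invwt n.
Proof.
by rewrite /invwt; case: mdecode => //= g; rewrite invr_ge0 ltW// polywt_gt0.
Qed.

Lemma invwt_mcode a : invwt (mcode a) = (polywt a)^-1.
Proof.
rewrite /invwt mcodeK /=; congr (_ ^-1).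
by apply: eq_bigr => i _; rewrite ffunE.
Qed.

(** A partial sum involves finitely many distinct multi-indices, all lying in one box, and the bound
    for boxes is independent of their size. *)
Lemma sum_invwt_le (N : nat) : \sum_(0 <= n < N) invwt n <= 2 ^+ d.
Proof.
pose s := pmap mdecode (index_iota 0 N).
have -> : \sum_(0 <= n < N) invwt n = \sum_(g <- s) (@polywt R d g)^-1.
  by rewrite big_pmap.
pose K := (\max_(g <- s) \max_(i < d) g i).+1.
pose lift (h : {ffun 'I_d -> 'I_K}) : {ffun 'I_d -> nat} := [ffun i => h i : nat].
apply: le_trans (sum_polywt_box K).
have -> : \sum_(h : {ffun 'I_d -> 'I_K}) (@polywt R d (fun i => h i : nat))^-1
    = \sum_(g <- map lift (enum {ffun 'I_d -> 'I_K})) (@polywt R d g)^-1.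
  rewrite big_map big_enum; apply: eq_bigr => h _; congr (_ ^-1).
  by apply: eq_bigr => i _; rewrite ffunE.
apply: ler_sum_uniq_sub.
- by move=> g; rewrite invr_ge0 ltW// polywt_gt0.
- by apply: (pmap_uniq (@pickle_invK {ffun 'I_d -> nat})); exact: iota_uniq.
- rewrite map_inj_uniq ?enum_uniq// => h h' /ffunP hh'; apply/ffunP => i.
  by apply/val_inj; have := hh' i; rewrite !ffunE.
move=> g gs; apply/mapP; exists [ffun i => inord (g i)]; first by rewrite mem_enum.
apply/ffunP => i; rewrite !ffunE inordK// ltnS.
apply: (@leq_trans (\max_(i < d) g i)%N); first exact: leq_bigmax.
exact: (@leq_bigmax_seq _ s xpredT (fun g => \max_(i < d) g i)%N).
Qed.

Lemma nneseries_invwt : (\sum_(0 <= n <oo) (invwt n)%:E < +oo)%E.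
Proof.
apply: (@le_lt_trans _ _ (2 ^+ d)%:E); last exact: ltry.
apply: lime_le; first by apply: is_cvg_nneseries => n _ _; rewrite lee_fin invwt_ge0.
by apply: nearW => N; rewrite sumEFin lee_fin sum_invwt_le.
Qed.

(** Terms of a convergent series tend to 0. This smallness is what later controls tails of sequences
    in a larger step. *)
Lemma invwt_cvg0 (e : R) : 0 < e ->
  exists N, forall n, (N <= n)%N -> invwt n <= e.
Proof.
move=> e0.
have : cvgn (series invwt).
  apply: nondecreasing_is_cvgn.
    apply/nondecreasing_seqP => n; rewrite /series/= big_nat_recr//= lerDl.
    exact: invwt_ge0.
  by exists (2 ^+ d) => _ [N _ <-]; exact: sum_invwt_le.
move=> /cvg_series_cvg_0/cvgrPdist_le/(_ _ e0)[N _ NP].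
exists N => n Nn; have := NP n Nn.
by rewrite sub0r normrN ger0_norm ?invwt_ge0.
Qed.

End Enumeration.

Lemma normc_ge0 {R : rcfType} (z : R[i]) : 0 <= Normc.normc z.
Proof. by case: z => x y; exact: sqrtr_ge0. Qed.

Lemma normc_real {R : rcfType} (r : R) : Normc.normc (r%:C)%C = `|r|.
Proof. by rewrite /= expr0n addr0 sqrtr_sqr. Qed.

(** * Step norms, restrictions and unit sequences *)

Section StepSpaces.
Context {R : realType} {d : nat}.
Implicit Types (c x : mindex d -> R[i]) (a : mindex d) (Mseq : mindex d -> R).
Local Notation normc := Normc.normc.

Lemma seqnorm_ge Mseq h c a :
  ((normc (c a))%:E * wt Mseq h a <= seqnorm Mseq h c)%E.
Proof. by apply: le_ereal_sup_tmp; eexists; [exists a|exact: lexx]. Qed.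

Lemma seqnorm_le Mseq h c (B : \bar R) :
  (forall a, ((normc (c a))%:E * wt Mseq h a <= B)%E) -> (seqnorm Mseq h c <= B)%E.
Proof. by move=> cB; apply: ge_ereal_sup => _ [a _ <-]; exact: cB. Qed.

Lemma seqnorm_ge0 Mseq h c : (0 <= seqnorm Mseq h c)%E.
Proof.
apply: le_trans (seqnorm_ge _ _ _ (@Defs.mzero d)).
by rewrite mule_ge0 ?lee_fin ?normc_ge0 ?expeR_ge0.
Qed.

Lemma le_seqnorm Mseq h c c' : (forall a, normc (c a) <= normc (c' a)) ->
  (seqnorm Mseq h c <= seqnorm Mseq h c')%E.
Proof.
move=> cc'; apply: seqnorm_le => a; apply: le_trans (seqnorm_ge _ _ _ a).
by rewrite lee_wpmul2r ?expeR_ge0 ?lee_fin.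
Qed.

Lemma seqnorm_scale Mseq h s c :
  (seqnorm Mseq h (sscale s c) <= (normc s)%:E * seqnorm Mseq h c)%E.
Proof.
apply: seqnorm_le => a; rewrite /sscale Normc.normcM EFinM -muleA.
by rewrite lee_wpmul2l ?lee_fin ?normc_ge0// seqnorm_ge.
Qed.

Lemma seqnorm_fin Mseq h c : (seqnorm Mseq h c < +oo)%E ->
  seqnorm Mseq h c = (fine (seqnorm Mseq h c))%:E.
Proof. by move=> c_fin; rewrite fineK// ge0_fin_numE// seqnorm_ge0. Qed.

Variable M : R -> mindex d -> R.
Hypothesis wM : weight_matrix M.

(** Raising either parameter lowers the weight, so any integer above both [l] and [h] serves. *)
Lemma LambdaR_step x : LambdaR M x ->
  exists j : nat, (0 < j)%N /\ (stepnorm M j x < +oo)%E.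
Proof.
have [M0 _ MM] := wM; move=> [l [h [l0 h0 xfin]]].
have lh0 : 0 <= Num.max l h by rewrite le_max ltW.
have jP := archi_boundP lh0; set j := Num.bound _ in jP.
move: jP; rewrite gt_max => /andP[lj hj].
exists j; split; first by rewrite -(ltr0n R) (lt_trans l0).
apply: le_lt_trans xfin; apply: seqnorm_le => a.
apply: le_trans (seqnorm_ge _ _ _ a).
apply: lee_wpmul2l; first by rewrite lee_fin normc_ge0.
by apply: le_wt; rewrite ?ltW// => b; [exact: M0|apply: MM; rewrite ?ltW].
Qed.

Lemma step_LambdaR j x : (0 < j)%N -> (stepnorm M j x < +oo)%E -> LambdaR M x.
Proof. by move=> j0 xj; exists j%:R, j%:R; rewrite !ltr0n. Qed.

Lemma LambdaR_le x y : LambdaR M y -> (forall a, normc (x a) <= normc (y a)) ->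
  LambdaR M x.
Proof.
move=> [l [h [l0 h0 xfin]]] xy; exists l, h; split => //.
exact: le_lt_trans (le_seqnorm _ _ _ _ xy) xfin.
Qed.

Lemma LambdaR_scale s x : LambdaR M x -> LambdaR M (sscale s x).
Proof.
move=> [l [h [l0 h0 xfin]]]; exists l, h; split => //.
apply: le_lt_trans (seqnorm_scale _ _ _ _) _.
by rewrite (seqnorm_fin _ _ _ xfin) -EFinM ltry.
Qed.

(** The predicate acts on codes, so heads, tails and single entries of the enumeration are all
    instances. *)
Definition restr (P : pred nat) x : mindex d -> R[i] :=
  fun a => if P (mcode a) then x a else 0.

Lemma restr_LambdaR P x : LambdaR M x -> LambdaR M (restr P x).
Proof.
move=> Lx; apply: LambdaR_le Lx _ => a; rewrite /restr.
by case: ifP => // _; rewrite Normc.normc0 normc_ge0.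
Qed.

Definition basis_seq a0 : mindex d -> R[i] := fun a => (mcode a == mcode a0)%:R.

Lemma restr_mcode a x : restr (pred1 (mcode a)) x = sscale (x a) (basis_seq a).
Proof.
apply/funext => b; rewrite /restr /sscale /basis_seq /=.
by case: eqP => [/mcode_inj ->|_]; rewrite ?mulr1 ?mulr0.
Qed.

Lemma seqnorm_basis Mseq h a : (seqnorm Mseq h (basis_seq a) <= wt Mseq h a)%E.
Proof.
apply: seqnorm_le => b; rewrite /basis_seq; case: eqP => [/mcode_inj ->|_].
  by rewrite Normc.normc1 mul1e.
by rewrite Normc.normc0 mul0e expeR_ge0.
Qed.

(** A unit sequence can lie outside [LambdaR M] when the weights at [a] are infinite. If [x a != 0],
    it is a multiple of a restriction of [x]. *)
Lemma basis_LambdaR a x : LambdaR M x -> x a != 0 -> LambdaR M (basis_seq a).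
Proof.
move=> Lx xa; have -> : basis_seq a = sscale (x a)^-1 (restr (pred1 (mcode a)) x).
  apply/funext => b; rewrite restr_mcode /sscale mulrA mulVf//.
  by rewrite mul1r.
exact/LambdaR_scale/restr_LambdaR.
Qed.

End StepSpaces.

(** * The dominating seminorm, the linear forms and the expansion in unit sequences *)

Section Nuclearity.
Context {R : realType} {d : nat}.
Variables (M : R -> mindex d -> R) (p : (mindex d -> R[i]) -> R).
Hypothesis wM : weight_matrix M.
Hypothesis MA : shift_stable M.
Hypothesis cp : cont_seminorm M p.
Implicit Types (x y : mindex d -> R[i]) (a : mindex d).
Local Notation normc := Normc.normc.

Lemma cont_seminorm_bound (m : nat) : (0 < m)%N -> exists C : R, 0 <= C /\
  forall x, (stepnorm M m x < +oo)%E -> ((p x)%:E <= C%:E * stepnorm M m x)%E.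
Proof.
move=> m0; have [_ /(_ m m0)[C CP]] := cp.
exists `|C|; split => // x xfin; apply: le_trans (CP x xfin) _.
by rewrite lee_wpmul2r ?seqnorm_ge0// lee_fin ler_norm.
Qed.

(* The absolute value matters only for [a] with [basis_seq a] outside
   [LambdaR M]: there [p] is arbitrary, but every [x] in [LambdaR M] has
   [x a = 0]. *)
Let g a : R := `|p (basis_seq a)|.

(** Continuity of [p] on step [m] bounds [p (basis_seq a)] by a multiple of the weight there, and
    [wt_growth] absorbs [polywt a] on passing to the weight of step [j]. *)
Lemma coef_bound (j : nat) : (0 < j)%N -> exists C : R, 0 <= C /\
  forall x, (stepnorm M j x < +oo)%E ->
  forall a, normc (x a) * (g a * polywt a) <= C * fine (stepnorm M j x).
Proof.
move=> j0; have [m [m0 [C1 [C10 C1P]]]] := wt_growth M wM MA j j0.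
have [C2 [C20 C2P]] := cont_seminorm_bound m m0.
exists (C2 * C1); split; first by rewrite mulr_ge0// ltW.
move=> x xfin a; have n0 := fine_ge0 (seqnorm_ge0 (M j%:R) j%:R x).
have [->|xa] := eqVneq (x a) 0.
  by rewrite Normc.normc0 mul0r mulr_ge0// mulr_ge0// ltW.
have nx : 0 < normc (x a).
  rewrite lt_neqAle normc_ge0 andbT eq_sym.
  by apply: contra xa => /eqP/Normc.eq0_normc ->.
have := seqnorm_ge (M j%:R) j%:R x a; have := C1P a.
have := seqnorm_basis (M m%:R) m%:R a.
have wj0 : (0 <= wt (M j%:R) j%:R a)%E by exact: expeR_ge0.
have wm0 : (0 <= wt (M m%:R) m%:R a)%E by exact: expeR_ge0.
rewrite (seqnorm_fin _ _ _ xfin).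
(* Since [x a != 0], an infinite weight in step [j] contradicts the finite norm of [x]; then an
   infinite weight in step [m] contradicts the weight estimate. *)
case: (wt (M j%:R) _ a) wj0 => [wj||]//= wj0; last first.
  by move=> _ _; rewrite gt0_muley ?lte_fin// leye_eq.
case: (wt (M m%:R) _ a) wm0 => [wm||]//= wm0; last first.
  by move=> _; rewrite gt0_muley ?lte_fin ?polywt_gt0// leye_eq.
rewrite -!EFinM => bw; rewrite !lee_fin => pw xw.
have bfin : (stepnorm M m (basis_seq a) < +oo)%E.
  by rewrite (le_lt_trans bw)// ltry.
have La : LambdaR M (basis_seq a).
  by apply: (basis_LambdaR M a x) => //; exact: step_LambdaR xfin.
have [[p0 _ _] _] := cp.
have gw : g a <= C2 * wm.
  rewrite /g ger0_norm ?p0// -lee_fin; apply: le_trans (C2P _ bfin) _.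
  by rewrite EFinM lee_wpmul2l.
have W0 := ltW (polywt_gt0 (R := R) a).
rewrite lee_fin in wm0.
apply: (@le_trans _ _ (normc (x a) * (C2 * wm * polywt a))).
  by rewrite ler_wpM2l ?normc_ge0// ler_wpM2r.
have -> : normc (x a) * (C2 * wm * polywt a) = C2 * (normc (x a) * (polywt a * wm)).
  by ring.
rewrite -mulrA ler_wpM2l//; apply: le_trans (ler_wpM2l (ltW nx) pw) _.
by rewrite mulrCA ler_wpM2l// ltW.
Qed.

Let term x a : R := normc (x a) * (g a * polywt a).
Let q x : R := sup (range (term x)).

Lemma term_ge0 x a : 0 <= term x a.
Proof. by rewrite !mulr_ge0 ?normc_ge0 ?normr_ge0// ltW// polywt_gt0. Qed.

(** A real [sup] is an upper bound only for bounded sets; on [LambdaR M], [coef_bound] provides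
    boundedness. *)
Lemma le_q x a : LambdaR M x -> term x a <= q x.
Proof.
move=> Lx; have [j [j0 xj]] := LambdaR_step M wM x Lx.
have [C [_ CP]] := coef_bound j j0.
apply: ub_le_sup; last by exists a.
by exists (C * fine (stepnorm M j x)) => _ [b _ <-]; exact: CP.
Qed.

Lemma q_le x B : (forall a, term x a <= B) -> q x <= B.
Proof.
move=> xB; apply: ge_sup; first by exists (term x (@Defs.mzero d)), (@Defs.mzero d).
by move=> _ [a _ <-].
Qed.

Lemma q_cont : cont_seminorm M q.
Proof.
have q0 x : LambdaR M x -> 0 <= q x.
  by move=> Lx; apply: le_trans (le_q x (@Defs.mzero d) Lx); exact: term_ge0.
have qs s x : LambdaR M x -> q (sscale s x) <= normc s * q x.
  move=> Lx; apply: q_le => a.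
  by rewrite /term /sscale Normc.normcM -mulrA ler_wpM2l ?normc_ge0//; exact: le_q.
split; first split=> //.
- move=> x y Lx Ly; apply: q_le => a.
  apply: le_trans (lerD (le_q x a Lx) (le_q y a Ly)).
  rewrite -mulrDl ler_wpM2r//; last exact: le_normcD.
  by rewrite mulr_ge0 ?normr_ge0// ltW// polywt_gt0.
- move=> s x Lx; apply/eqP; rewrite eq_le qs//=.
  have [->|s0] := eqVneq s 0.
    by rewrite Normc.normc0 mul0r q0//; exact: LambdaR_scale.
  have ns : 0 < normc s.
    rewrite lt_neqAle normc_ge0 andbT eq_sym.
    by apply: contra s0 => /eqP/Normc.eq0_normc ->.
  (* The reverse inequality is [qs] for the scalar [s^-1] and the sequence [s x]. *)
  rewrite mulrC -ler_pdivlMr// mulrC -Normc.normcV.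
  rewrite -[X in q X <= _](_ : sscale s^-1 (sscale s x) = x); last first.
    by apply/funext => a; rewrite /sscale mulrA mulVf// mul1r.
  by apply: qs; exact: LambdaR_scale.
- move=> j j0; have [C [C0 CP]] := coef_bound j j0.
  exists C => x xfin; rewrite /stepnorm (seqnorm_fin _ _ _ xfin) -EFinM lee_fin.
  by apply: q_le => a; exact: CP.
Qed.

Let f (n : nat) x : R[i] :=
  oapp (fun b : {ffun 'I_d -> nat} => x b * ((g b)%:C)%C) 0 (mdecode n).

Lemma normc_f_mcode x a : normc (f (mcode a) x) = normc (x a) * g a.
Proof.
rewrite /f mcodeK /=.
have -> : (finfun a : mindex d) = a by apply/funext => i; rewrite ffunE.
by rewrite Normc.normcM normc_real normr_id.
Qed.

Lemma mdecode_None n : mdecode (d := d) n = None -> forall a, mcode a != n.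
Proof. by move=> dn a; apply: contra_eq_neq dn => <-; rewrite mcodeK. Qed.

(** The factor [polywt] built into [q] is divided out here and becomes the summable coefficient. *)
Lemma f_le n x : LambdaR M x -> normc (f n x) <= @invwt R d n * q x.
Proof.
move=> Lx; case dn: (mdecode (d := d) n) => [b|]; last first.
  have -> : f n x = 0 by rewrite /f dn.
  by rewrite Normc.normc0 /invwt dn /= mul0r.
rewrite -(mdecodeK _ _ dn) normc_f_mcode invwt_mcode [leRHS]mulrC ler_pdivlMr ?polywt_gt0//.
by rewrite -mulrA; exact: le_q.
Qed.

(** Subadditivity, splitting off one number at a time; a number that codes nothing contributes the
    zero sequence. *)
Lemma p_restr_le x (N : nat) : LambdaR M x ->
  p (restr (fun n => (n < N)%N) x) <= \sum_(0 <= n < N) normc (f n x).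
Proof.
move=> Lx; have [[p0 pD pZ] _] := cp.
have pzero : p (fun=> 0) = 0.
  have := pZ 0 x Lx; rewrite Normc.normc0 mul0r => <-; congr p.
  by apply/funext => a; rewrite /sscale mul0r.
elim: N => [|N IH].
  rewrite big_nil -[X in _ <= X]pzero le_eqVlt; apply/orP; left; apply/eqP.
  by congr p; apply/funext => a.
rewrite big_nat_recr//=.
have -> : restr (fun n => (n < N.+1)%N) x
    = sadd (restr (fun n => (n < N)%N) x) (restr (pred1 N) x).
  apply/funext => a; rewrite /restr /sadd /= ltnS leq_eqVlt.
  by case: ltngtP; rewrite ?addr0 ?add0r.
apply: le_trans (pD _ _ _ _) _; [exact: restr_LambdaR..|].
apply: lerD => //; case dN: (mdecode (d := d) N) => [b|]; last first.
  have -> : restr (pred1 N) x = fun=> 0.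
    by apply/funext => a; rewrite /restr /= (negbTE (mdecode_None _ dN a)).
  by rewrite pzero normc_ge0.
rewrite -(mdecodeK _ _ dN) normc_f_mcode.
(* Homogeneity of [p] at [basis_seq b] requires membership in [LambdaR M], known only if [x b != 0];
   otherwise the entry is the zero sequence. *)
have [xb|xb] := eqVneq (x b) 0.
  rewrite xb Normc.normc0 mul0r -[X in _ <= X]pzero le_eqVlt; apply/orP; left; apply/eqP.
  by congr p; rewrite restr_mcode xb; apply/funext => a; rewrite /sscale mul0r.
by rewrite restr_mcode pZ ?ler_wpM2l ?normc_ge0 ?ler_norm//; exact: basis_LambdaR Lx xb.
Qed.

(** In step [m] the weight is at most [C1 / polywt] times that of step [j], and [1 / polywt] is
    uniformly small on the tail. So the tails tend to 0 in step [m], where [p] is bounded. *)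
Lemma p_tail_le x (e : R) : LambdaR M x -> 0 < e ->
  exists N, p (restr (fun n => (N <= n)%N) x) <= e.
Proof.
move=> Lx e0; have [j [j0 xj]] := LambdaR_step M wM x Lx.
have [m [m0 [C1 [C10 C1P]]]] := wt_growth M wM MA j j0.
have [C2 [C20 C2P]] := cont_seminorm_bound m m0.
set nx := fine (stepnorm M j x).
have nx0 : 0 <= nx by exact/fine_ge0/seqnorm_ge0.
(* Dividing [e] by this makes [C2 * C1 * nx * e' <= e]; the added 1 keeps the divisor positive. *)
have D0 : 0 < C2 * C1 * nx + 1 by rewrite ltr_wpDl// !mulr_ge0// ltW.
have [e' e'E] : {e' | e' = e / (C2 * C1 * nx + 1)} by eexists.
have e'0 : 0 < e' by rewrite e'E divr_gt0.
have [N NP] := invwt_cvg0 (R := R) (d := d) _ e'0.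
exists N; set y := restr _ x.
have ny : (stepnorm M m y <= (e' * C1 * nx)%:E)%E.
  apply: seqnorm_le => a; rewrite /y /restr; case: ifP => Na; last first.
    by rewrite Normc.normc0 mul0e lee_fin !mulr_ge0 ?(ltW e'0) ?(ltW C10).
  have wle : (wt (M m%:R) m%:R a <= (e' * C1)%:E * wt (M j%:R) j%:R a)%E.
    have := NP _ Na; rewrite invwt_mcode => We.
    apply: (@le_trans _ _ ((polywt a)^-1%:E * ((polywt a)%:E * wt (M m%:R) m%:R a))%E).
      by rewrite muleA -EFinM mulVf ?mul1e// gt_eqF// polywt_gt0.
    apply: le_trans (lee_wpmul2l _ (C1P a)) _.
      by rewrite lee_fin invr_ge0 ltW// polywt_gt0.
    rewrite muleA -EFinM lee_wpmul2r ?expeR_ge0// lee_fin ler_wpM2r// ltW//.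
  apply: le_trans (lee_wpmul2l _ wle) _; first by rewrite lee_fin normc_ge0.
  rewrite muleCA [X in (_ <= X)%E]EFinM lee_wpmul2l//.
    by rewrite lee_fin mulr_ge0// ltW.
  rewrite /nx -(seqnorm_fin _ _ _ xj); exact: seqnorm_ge.
have yfin : (stepnorm M m y < +oo)%E by rewrite (le_lt_trans ny)// ltry.
have : ((p y)%:E <= C2%:E * (e' * C1 * nx)%:E)%E.
  by apply: le_trans (C2P y yfin) _; rewrite lee_wpmul2l.
rewrite -EFinM lee_fin => /le_trans; apply.
have -> : C2 * (e' * C1 * nx) = e' * (C2 * C1 * nx) by ring.
by rewrite e'E mulrAC ler_pdivrMr// ler_wpM2l ?ltW// ltrDl.
Qed.

(** Cut [x] at [N]: the head is bounded by a partial sum of the series, the tail by an arbitrary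
    [e > 0]. *)
Lemma p_le_series x : LambdaR M x ->
  ((p x)%:E <= \sum_(0 <= n <oo) (normc (f n x))%:E)%E.
Proof.
move=> Lx; have [[p0 pD pZ] _] := cp.
apply/lee_addgt0Pr => e e0; have [N Ne] := p_tail_le x e Lx e0.
have xE : sadd (restr (fun n => (n < N)%N) x) (restr (fun n => (N <= n)%N) x) = x.
  by apply/funext => a; rewrite /restr /sadd; case: ltnP; rewrite ?addr0 ?add0r.
apply: (@le_trans _ _ ((\sum_(0 <= n < N) normc (f n x))%:E + e%:E)%E).
  rewrite -EFinD lee_fin -{1}xE; apply: le_trans (pD _ _ _ _) _.
  - exact: restr_LambdaR.
  - exact: restr_LambdaR.
  - by apply: lerD => //; exact: p_restr_le.
rewrite leeD2r// -sumEFin; apply: nneseries_lim_ge => n _ _.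
by rewrite lee_fin normc_ge0.
Qed.

Lemma seminorm_domination : exists q, cont_seminorm M q /\
  exists (f : nat -> (mindex d -> R[i]) -> R[i]) (a : nat -> R),
    [/\ forall n, linear_on (LambdaR M) (f n),
        forall n, 0 <= a n,
        forall n x, LambdaR M x -> normc (f n x) <= a n * q x,
        (\sum_(0 <= n <oo) (a n)%:E < +oo)%E
      & forall x, LambdaR M x ->
          ((p x)%:E <= \sum_(0 <= n <oo) (normc (f n x))%:E)%E].
Proof.
exists q; split; first exact: q_cont.
exists f, (@invwt R d); split.
- move=> n; rewrite /f; case: mdecode => [b|]; split => //=.
  + by move=> x y _ _; rewrite /sadd mulrDl.
  + by move=> s x _; rewrite /sscale mulrA.
  + by move=> x y _ _; rewrite addr0.
  + by move=> s x _; rewrite mulr0.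
- exact: invwt_ge0.
- exact: f_le.
- exact: nneseries_invwt.
- exact: p_le_series.
Qed.

End Nuclearity.

Theorem theorem5p4 (R : realType) (d : nat) (M : R -> mindex d -> R) :
  weight_matrix M ->
  (forall l : R, 0 < l -> exists k A : R, [/\ l <= k, 1 <= A &
     forall (a : mindex d) (j : 'I_d),
       M l (maddn a (unitvec j)) <= A ^+ (mlen a).+1 * M k a]) ->
  nuclear_Lambda M.
Proof. by move=> wM MA p cp; exact: seminorm_domination. Qed.
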